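(* For every integer $n\ge 2$, we have $$n\log 2-\frac{12n}{\log n}\le d(n)\le n\log 2+\frac{19n}{2\log n}+\frac{137n}{2\log^2 n}+\frac{4\sqrt{n}}{\log n}+\frac{3\sqrt{n}}{2}\log n\le n\log 2+\frac{112n}{\log n}.$$ In particular, $d(n)=n\log 2+O(n/\log n)$.
   Context: $\log$ is the natural logarithm and $\log^2 n=(\log n)^2$. For a positive integer $n$, $\mathrm{Sym}(n)$ is the symmetric group of degree $n$; for a prime $p$, $d_p(n)$ denotes the minimal number of generators of a Sylow $p$-subgroup of $\mathrm{Sym}(n)$ (so $d_p(n)=0$ if $p>n$), and $d(n):=\sum_{p\text{ prime}}d_p(n)$. *)

(* Defs.v *)
From mathcomp Require Import all_boot all_fingroup all_solvable.

Set Implicit Arguments.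
Unset Strict Implicit.
Unset Printing Implicit Defensive.
Local Open Scope group_scope.
Local Open Scope nat_scope.

(* [sylow_gen_rankE] shows that the choice of the Sylow subgroup is
   irrelevant. *)
Definition sylow_gen_rank (p n : nat) : nat :=
  'm(sval (Sylow_exists p [set: 'S_n]%G)).

(* The sum over all primes is truncated at n, see [sylow_gen_rank0]. *)
Definition total_gen_rank (n : nat) : nat :=
  \sum_(0 <= p < n.+1 | prime p) sylow_gen_rank p n.

Lemma sylow_gen_rankE (p n : nat) (P : {group 'S_n}) :
  p.-Sylow([set: 'S_n]) P -> sylow_gen_rank p n = 'm(P).
Proof.
rewrite /sylow_gen_rank => sylP; case: Sylow_exists => Q sylQ /=.
have [x _ ->] := Sylow_trans sylP sylQ.
exact/esym/isog_grank/conj_isog.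
Qed.

Lemma sylow_gen_rank0 (p n : nat) :
  prime p -> n < p -> sylow_gen_rank p n = 0.
Proof.
move=> p_pr lt_np; rewrite (@sylow_gen_rankE p n 1%G); last first.
  rewrite pHallE sub1G cards1 eq_sym /= part_p'nat // p'natE //.
  rewrite cardsT card_Sn; apply/negP; elim: n lt_np => [_|n IHn lt_np].
    by rewrite fact0 dvdn1 => /eqP p1; rewrite p1 in p_pr.
  rewrite factS Euclid_dvdM // => /orP[|]; last exact/IHn/ltnW.
  by rewrite gtnNdvd.
have := grank_min (set0 : {set 'S_n}).
by rewrite gen0 cards0 leqn0 => /eqP.
Qed.

Lemma total_gen_rank_widen (n N : nat) :
  n <= N -> \sum_(0 <= p < N.+1 | prime p) sylow_gen_rank p n = total_gen_rank n.
Proof.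
move=> le_nN; rewrite /total_gen_rank (big_cat_nat (n := n.+1)) //=.
rewrite [X in _ + X](_ : _ = 0) ?addn0 // big_nat_cond big1 // => p.
by case/andP=> /andP[lt_np _] p_pr; apply: sylow_gen_rank0.
Qed.

(* Main.v *)
(** [d_p(n)] is [sum_i i a_i] over the base-[p] digits [a_i] of [n]; in
    particular it is [floor (n / p)] when [p ^ 2 > n].  Hence [d(n)] is
    [n * sum_(sqrt n < p <= n) 1 / p] up to [O(n / log n)]: the fractional parts
    cost at most the number of primes up to [n], and the primes below [sqrt n]
    contribute about [sum_(p <= sqrt n) p].  Both are controlled by Chebyshev's
    bound [theta(n) <= n log 4].  By Mertens' first theorem
    [sum_(p <= n) log p / p = log n + O(1)], and Abel summation turns this into
    [sum_(sqrt n < p <= n) 1 / p = log 2 + O(1 / log n)], the main term being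
    [log log n - log log (sqrt n) = log 2]. *)

(* The digit formula is proved only as an upper bound, from explicit generators of an iterated
   wreath product. An exact rank is needed only when [n < p ^ 2], where the Sylow subgroup is
   elementary abelian and its order gives its rank; the lower bound drops all smaller primes. In the
   upper bound the primes up to [sqrt n] are the obstacle: [n / p] summed over them has order
   [n log log n]. The digit formula offers two substitutes: [p + 2 n / p ^ 2], whose second term
   still sums to order [n] if the smallest primes are included, and a bound of order [p log^2 n],
   too large near [sqrt n]. Switching between them at [n ^ (1/4)] leaves errors of order [n ^ (3/4)]
   and [sqrt n log^2 n], and [log^2 n <= 9 n ^ (1/4)] compares these with [n / log^2 n]. *)
Require Import Defs.
From mathcomp Require Import all_boot all_algebra all_fingroup all_solvable.
From mathcomp Require Import zify.

Set Implicit Arguments.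
Unset Strict Implicit.
Unset Printing Implicit Defensive.
Import GRing.Theory.
Local Open Scope nat_scope.

(** * Imprimitive wreath products with a cyclic group *)

Section Wreath.
Context (q m n : nat) (le_mn : m * q.+2 <= n).
Local Notation p := q.+2.
Implicit Types (v : {ffun 'I_m -> 'I_p}) (s : {perm 'I_m}).

Lemma block_proof (j : 'I_m) (a : 'I_p) : j * p + a < n.
Proof.
apply: leq_trans le_mn; apply: (@leq_trans (j.+1 * p)).
  by rewrite mulSn addnC ltn_add2r.
by rewrite leq_mul2r ltn_ord orbT.
Qed.

(* The pairs [(j, a)] exhaust the points below [m * p]; the remaining points are
   fixed by the wreath product. *)
Definition block (j : 'I_m) (a : 'I_p) : 'I_n := Ordinal (block_proof j a).

Lemma block_inj j a j' a' : block j a = block j' a' -> j = j' /\ a = a'.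
Proof.
move/(congr1 val) => /= e; split; apply: val_inj => /=.
  have := congr1 (divn^~ p) e.
  by rewrite /= !divnMDl // !divn_small ?ltn_ord // !addn0.
have := congr1 (modn^~ p) e.
by rewrite /= !modnMDl !modn_small ?ltn_ord.
Qed.

Variant block_spec (i : 'I_n) : Prop :=
  | BlockIn j a of i = block j a
  | BlockOut of m * p <= i.

Lemma blockP i : block_spec i.
Proof.
case: (leqP (m * p) i) => [|ltim]; first by right.
have ltj : i %/ p < m by rewrite ltn_divLR.
by left with (Ordinal ltj) (inZp i); apply: val_inj; rewrite /= -divn_eq.
Qed.

(** The point [(j, a)] goes to [(s j, a + v j)]. Writing [p] as [q.+2] makes ['I_p] the ring of
    integers modulo [p], and [inZp i] recovers [a] because [i = j * p + a]. Outside the blocks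
    [insub] fails and the point is fixed. *)
Definition wreath_fun v s (i : 'I_n) : 'I_n :=
  if insub (i %/ p) is Some j then block (s j) (inZp i + v j)%R else i.

Lemma wreath_fun_in v s j a :
  wreath_fun v s (block j a) = block (s j) (a + v j)%R.
Proof.
rewrite /wreath_fun; have e : block j a %/ p = j.
  by rewrite /= divnMDl // divn_small ?ltn_ord ?addn0.
rewrite insubT ?e ?ltn_ord // => lt_j.
have -> : Sub (j : nat) lt_j = j by apply: val_inj.
congr (block _ (_ + _)%R).
by apply: val_inj; rewrite /= modnMDl modn_small ?ltn_ord.
Qed.

Lemma wreath_fun_out v s (i : 'I_n) : m * p <= i -> wreath_fun v s i = i.
Proof. by move=> le_i; rewrite /wreath_fun insubF // ltn_divLR // ltnNge le_i. Qed.

Lemma wreath_funM v s v' s' i :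
  wreath_fun v' s' (wreath_fun v s i)
    = wreath_fun [ffun j => v j + v' (s j)]%R (s * s')%g i.
Proof.
case: (blockP i) => [j a ->|le_i]; last by rewrite !wreath_fun_out.
by rewrite !wreath_fun_in permM ffunE addrA.
Qed.

Lemma wreath_fun1 i : wreath_fun [ffun=> 0%R] 1%g i = i.
Proof.
case: (blockP i) => [j a ->|le_i]; last by rewrite wreath_fun_out.
by rewrite wreath_fun_in perm1 ffunE addr0.
Qed.

Lemma wreath_fun_inj v s : injective (wreath_fun v s).
Proof.
apply: (can_inj (g := wreath_fun [ffun j => - v (s^-1%g j)]%R s^-1%g)) => i.
rewrite wreath_funM mulgV; rewrite -[RHS]wreath_fun1; congr wreath_fun.
by apply/ffunP => j; rewrite !ffunE permK subrr.
Qed.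

Definition wreath_perm v s : {perm 'I_n} := perm (@wreath_fun_inj v s).

Lemma wreath_perm_in v s j a :
  wreath_perm v s (block j a) = block (s j) (a + v j)%R.
Proof. by rewrite permE wreath_fun_in. Qed.

Lemma wreath_permM v s v' s' :
  (wreath_perm v s * wreath_perm v' s')%g
    = wreath_perm [ffun j => v j + v' (s j)]%R (s * s')%g.
Proof. by apply/permP => i; rewrite permM !permE wreath_funM. Qed.

Lemma wreath_perm1 : wreath_perm [ffun=> 0%R] 1%g = 1%g.
Proof. by apply/permP => i; rewrite perm1 permE wreath_fun1. Qed.

Lemma wreath_perm_inj : injective (fun u => wreath_perm u.1 u.2).
Proof.
move=> [v s] [v' s'] /= /permP eq_w.
have eq_vs j : s j = s' j /\ v j = v' j.
  have := eq_w (block j 0%R); rewrite !wreath_perm_in !add0r.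
  exact: block_inj.
congr (_, _); first by apply/ffunP => j; case: (eq_vs j).
by apply/permP => j; case: (eq_vs j).
Qed.

Definition wreath_set (Q : {set {perm 'I_m}}) : {set {perm 'I_n}} :=
  [set wreath_perm u.1 u.2 | u in setX [set: {ffun 'I_m -> 'I_p}] Q].

Lemma mem_wreath (Q : {set {perm 'I_m}}) v s :
  s \in Q -> wreath_perm v s \in wreath_set Q.
Proof. by move=> Qs; apply/imsetP; exists (v, s); rewrite // !inE. Qed.

Lemma wreathP (Q : {set {perm 'I_m}}) w :
  reflect (exists v, exists2 s, s \in Q & w = wreath_perm v s)
          (w \in wreath_set Q).
Proof.
apply: (iffP imsetP) => [[[v s]]|[v [s Qs ->]]]; last first.
  by exists (v, s); rewrite // !inE.
by rewrite !inE => /= Qs ->; exists v, s.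
Qed.

Lemma group_set_wreath (Q : {group {perm 'I_m}}) : group_set (wreath_set Q).
Proof.
apply/group_setP; split; first by rewrite -wreath_perm1 mem_wreath.
move=> _ _ /wreathP[v [s Qs ->]] /wreathP[v' [s' Qs' ->]].
by rewrite wreath_permM mem_wreath ?groupM.
Qed.

Canonical wreath_group Q := Group (group_set_wreath Q).

Lemma card_wreath (Q : {set {perm 'I_m}}) :
  #|wreath_set Q| = (p ^ m * #|Q|)%N.
Proof.
rewrite card_imset ?cardsX; last exact: wreath_perm_inj.
by rewrite cardsT card_ffun !card_ord.
Qed.

Definition base_cycle (j : 'I_m) : {perm 'I_n} :=
  wreath_perm [ffun k => ((k == j)%:R)%R] 1%g.

(** Conjugating [base_cycle o] by the lift of [s] gives [base_cycle (s o)]. One base cycle per orbit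
    of [Q] therefore produces all of them, and their powers multiply to every element of the base
    group. *)
Lemma wreath_gen (Q : {group {perm 'I_m}}) (X : {set {perm 'I_m}})
    (O : {set 'I_m}) :
    <<X>>%g = Q -> (forall i, exists2 o, o \in O & exists2 s, s \in Q & s o = i) ->
  wreath_set Q =
    <<[set wreath_perm [ffun=> 0%R] s | s in X] :|: [set base_cycle j | j in O]>>%g.
Proof.
move=> genX transO; set Y := _ :|: _.
apply/eqP; rewrite eqEsubset; apply/andP; split; last first.
  rewrite gen_subG; apply/subsetP => w /setUP[] /imsetP[].
    by move=> s Xs ->; rewrite mem_wreath // -genX mem_gen.
  by move=> j _ ->; rewrite mem_wreath.
have liftM s s' : wreath_perm [ffun=> 0%R] (s * s')%g =
    (wreath_perm [ffun=> 0%R] s * wreath_perm [ffun=> 0%R] s')%g.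
  by rewrite wreath_permM; congr wreath_perm; apply/ffunP => j; rewrite !ffunE addr0.
have liftY s : s \in Q -> wreath_perm [ffun=> 0%R] s \in <<Y>>%g.
  rewrite -genX => /gen_prodgP[k [c Xc ->]].
  elim/big_ind: _ => [|s1 s2 H1 H2|i _]; first by rewrite wreath_perm1.
    by rewrite liftM groupM.
  by rewrite mem_gen // inE imset_f.
have cycY j : base_cycle j \in <<Y>>%g.
  have [o Oo [s Qs so]] := transO j.
  suff -> : base_cycle j = ((wreath_perm [ffun=> 0%R] s)^-1
      * base_cycle o * wreath_perm [ffun=> 0%R] s)%g.
    by rewrite !groupM ?groupV ?liftY // mem_gen // inE imset_f ?orbT.
  apply: (mulgI (wreath_perm [ffun=> 0%R] s)); rewrite !mulgA mulgV mul1g.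
  rewrite !wreath_permM mulg1 mul1g; congr wreath_perm; apply/ffunP => k.
  by rewrite !ffunE add0r addr0 -so (inj_eq perm_inj).
apply/subsetP => _ /wreathP[v [s Qs ->]].
have -> : wreath_perm v s = (wreath_perm v 1 * wreath_perm [ffun=> 0%R] s)%g.
  rewrite wreath_permM mul1g; congr wreath_perm; apply/ffunP => j.
  by rewrite !ffunE addr0.
rewrite groupM ?liftY //.
have baseM v1 v2 : wreath_perm (v1 + v2)%R 1%g =
    (wreath_perm v1 1 * wreath_perm v2 1)%g.
  rewrite wreath_permM mulg1; congr wreath_perm.
  by apply/ffunP => j; rewrite !ffunE perm1.
have base0 : wreath_perm 0%R 1%g = 1%g.
  by rewrite -wreath_perm1; congr wreath_perm; apply/ffunP => j; rewrite !ffunE.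
have -> : v = (\sum_j [ffun k => (k == j)%:R] *+ v j)%R.
  apply/ffunP => k; rewrite sum_ffunE (bigD1 k) //= big1 => [|j jk].
    by rewrite addr0 ffunMnE ffunE eqxx natr_Zp.
  by rewrite ffunMnE ffunE eq_sym (negPf jk) mul0rn.
elim/big_ind: _ => [|v1 v2 H1 H2|j _]; first by rewrite base0 group1.
  by rewrite baseM groupM.
elim: (val (v j)) => [|a IH]; first by rewrite mulr0n base0 group1.
by rewrite mulrS baseM groupM // cycY.
Qed.

End Wreath.

(** * Ranks of Sylow subgroups of symmetric groups *)

Fixpoint digit_sum (p k n : nat) : nat :=
  if k is k'.+1 then n %% p + digit_sum p k' (n %/ p) else 0.

(* For [n < p ^ k] this is [sum_i i a_i] over the base-[p] digits [a_i] of [n]. *)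
Fixpoint gen_bound (p k n : nat) : nat :=
  if k is k'.+1 then gen_bound p k' (n %/ p) + digit_sum p k' (n %/ p) else 0.

Lemma logn_fact_div p n : prime p -> logn p n`! = n %/ p + logn p (n %/ p)`!.
Proof.
move=> p_pr; have p_gt1 := prime_gt1 p_pr.
case: n => [|n]; first by rewrite div0n fact0 logn1.
rewrite !logn_fact // big_nat_recl // expn1; congr (_ + _).
have lt_m : n.+1 %/ p < n.+1 by rewrite ltn_Pdiv.
under eq_bigr do rewrite expnS divnMA.
rewrite (@big_cat_nat _ _ _ (n.+1 %/ p).+1 1 n.+1) //=.
rewrite -[RHS]addn0; congr (_ + _).
rewrite big_nat_cond big1 // => i /andP[/andP[lti _] _].
by rewrite divn_small // (leq_trans lti) // ltnW // ltn_expl.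
Qed.

(** Adding the digit sum lets the induction close: with [m = n %/ p], the left side for [k.+1] is at
    most [m + digit_sum p k m + n %% p], and [digit_sum p k m <= m] leaves [2 * m <= p * m]. *)
Lemma leq_gen_bound_digit_sum p k n :
  1 < p -> gen_bound p k n + digit_sum p k n <= n.
Proof.
move=> p_gt1; elim: k n => [|k IH] n //=; have := IH (n %/ p).
have := divn_eq n p; nia.
Qed.

Lemma card_ord_geq n a : #|[set i : 'I_n | a <= i]| = n - a.
Proof.
by rewrite -sum1dep_card -(big_geq_mkord _ _ xpredT (fun=> 1)) sum_nat_const_nat muln1.
Qed.

(* The invariant carries a set [O] meeting every orbit, since one new generator
   is needed for each orbit of the top group of the wreath product. *)
Lemma sylow_perm_gen p k n : prime p -> n < p ^ k ->
  exists (P : {group {perm 'I_n}}) (X : {set {perm 'I_n}}) (O : {set 'I_n}),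
    [/\ #|P| = p ^ logn p n`!, <<X>>%g = P, #|X| <= gen_bound p k n,
        #|O| <= digit_sum p k n
      & forall i, exists2 o, o \in O & exists2 s, s \in P & s o = i].
Proof.
case: p => [|[|q]] // p_pr; set p := q.+2 in p_pr *.
elim: k n => [|k IH] n ltn.
  case: n ltn => // _; exists 1%G, set0, set0.
  by split; [rewrite cards1 logn1 | exact: gen0 | rewrite cards0 | rewrite cards0 | case].
set m := n %/ p; have le_mn : m * p <= n by rewrite leq_trunc_div.
have ltm : m < p ^ k by rewrite ltn_divLR // -expnSr.
have [Q [X [O [cardQ genX leX leO trO]]]] := IH m ltm.
exists (wreath_group le_mn Q).
exists ([set wreath_perm le_mn [ffun=> 0%R] s | s in X]
          :|: [set base_cycle le_mn j | j in O]).
(* A whole block row over an orbit of [Q] is a single orbit, represented by [(o, 0)]; each of the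
   [n %% p] remaining points is an orbit by itself. *)
exists ([set block le_mn o 0%R | o in O] :|: [set i : 'I_n | m * p <= i]).
split => /=.
- by rewrite card_wreath cardQ -expnD (logn_fact_div n p_pr).
- by rewrite -(wreath_gen le_mn genX trO).
- apply: leq_trans (leq_card_setU _ _) _.
  by rewrite leq_add // (leq_trans (leq_imset_card _ _)).
- apply: leq_trans (leq_card_setU _ _) _.
  rewrite addnC leq_add // ?(leq_trans (leq_imset_card _ _)) //.
  by rewrite card_ord_geq {1}(divn_eq n p) addKn.
move=> i; case: (blockP le_mn i) => [j a ->|le_i]; last first.
  by exists i; [rewrite !inE le_i orbT | exists 1%g; rewrite ?group1 ?perm1].
have [o Oo [s Qs so]] := trO j; exists (block le_mn o 0%R).
  by apply/setUP; left; apply/imsetP; exists o.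
exists (wreath_perm le_mn [ffun=> a] s); first exact: mem_wreath.
by rewrite wreath_perm_in so ffunE add0r.
Qed.

Lemma sylow_sym_card p n (P : {group {perm 'I_n}}) :
  #|P| = p ^ logn p n`! -> (p.-Sylow([set: {perm 'I_n}]) P)%g.
Proof. by move=> cardP; rewrite pHallE subsetT cardsT card_Sn p_part cardP /=. Qed.

Lemma sylow_gen_rank_le p k n :
  prime p -> n < p ^ k -> sylow_gen_rank p n <= gen_bound p k n.
Proof.
move=> p_pr ltn; have [P [X [_ [cardP genX leX _ _]]]] := sylow_perm_gen p_pr ltn.
by rewrite (sylow_gen_rankE (sylow_sym_card cardP)) -genX (leq_trans (grank_min _)).
Qed.

(** Here [m = n %/ p] is less than [p], so the top group can be trivial: the base group alone has
    the full [p]-part of the order. It is elementary abelian of order [p ^ m], hence of rank [m]. *)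
Lemma sylow_gen_rank_large p n :
  prime p -> n < p ^ 2 -> sylow_gen_rank p n = n %/ p.
Proof.
case: p => [|[|q]] // p_pr lt_np2; set p := q.+2 in p_pr lt_np2 *.
set m := n %/ p; have le_mn : m * p <= n by rewrite leq_trunc_div.
have ltm : m < p by rewrite ltn_divLR.
have abelW : (p.-abelem (wreath_group le_mn 1))%g.
  apply/abelemP => //; split.
    apply/centsP => _ /wreathP[v [_ /set1P-> ->]] _ /wreathP[v' [_ /set1P-> ->]].
    rewrite /commute !wreath_permM; congr wreath_perm.
    by apply/ffunP => j; rewrite !ffunE !perm1 addrC.
  move=> _ /wreathP[v [_ /set1P-> ->]].
  have powW a : (wreath_perm le_mn v 1 ^+ a)%g = wreath_perm le_mn (v *+ a)%R 1.
    elim: a => [|a IH].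
      by rewrite expg0 -(wreath_perm1 le_mn).
    rewrite expgS IH wreath_permM mulg1; congr wreath_perm.
    by apply/ffunP => j; rewrite mulrS !ffunE perm1.
  rewrite powW -(wreath_perm1 le_mn); congr wreath_perm.
  apply/ffunP => j; rewrite ffunMnE ffunE -mulr_natr.
  by rewrite [X in (_ * X)%R](@pchar_Zp p isT) mulr0.
have cardW : #|wreath_group le_mn 1| = p ^ m by rewrite card_wreath cards1 muln1.
rewrite (@sylow_gen_rankE p n (wreath_group le_mn 1)).
  by rewrite grank_abelian ?(abelem_abelian abelW) // (rank_abelem abelW) cardW pfactorK.
apply: sylow_sym_card; rewrite cardW logn_fact_div // -/m.
rewrite (logn_fact_div m p_pr) (divn_small ltm) fact0 logn1 !addn0.
by [].
Qed.

Lemma digit_sum_le p k n : 1 < p -> digit_sum p k n <= p.-1 * k.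
Proof.
move=> p_gt1; elim: k n => [|k IH] n //=.
by have := IH (n %/ p); have := ltn_pmod n (ltnW p_gt1); nia.
Qed.

(** Each digit is at most [p - 1], and the weights [0, ..., k - 1] add up to ['C(k, 2)]. *)
Lemma gen_bound_le_bin p k n : 1 < p -> gen_bound p k n <= p.-1 * 'C(k, 2).
Proof.
move=> p_gt1; elim: k n => [|k IH] n //=.
by rewrite binS bin1 mulnDr addnC addnC leq_add ?IH ?digit_sum_le.
Qed.

Lemma gen_bound_le_div p k n : 1 < p -> gen_bound p k n <= n %/ p.
Proof. by case: k => // k p_gt1; apply: leq_gen_bound_digit_sum. Qed.

(** Two unfoldings isolate the digit of weight 1, which is less than [p]; the rest is controlled by
    [n %/ p ^ 2], once through the generators and once more through the extra digit sum. *)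
Lemma gen_bound_le_sqr p k n : 1 < p -> gen_bound p k n <= p + 2 * (n %/ p ^ 2).
Proof.
move=> p_gt1; case: k => [|[|k]] //=.
have := leq_gen_bound_digit_sum k (n %/ p %/ p) p_gt1.
have := ltn_pmod (n %/ p) (ltnW p_gt1); rewrite -divnMA mulnn; lia.
Qed.

Lemma sylow_gen_rank_le_div p n : prime p -> sylow_gen_rank p n <= n %/ p.
Proof.
move=> p_pr; have p_gt1 := prime_gt1 p_pr.
by rewrite (leq_trans (sylow_gen_rank_le p_pr (ltn_expl n p_gt1))) ?gen_bound_le_div.
Qed.

Lemma sylow_gen_rank_le_sqr p n :
  prime p -> sylow_gen_rank p n <= p + 2 * (n %/ p ^ 2).
Proof.
move=> p_pr; have p_gt1 := prime_gt1 p_pr.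
by rewrite (leq_trans (sylow_gen_rank_le p_pr (ltn_expl n p_gt1))) ?gen_bound_le_sqr.
Qed.

Lemma sylow_gen_rank_le_bin p k n :
  prime p -> n < p ^ k -> sylow_gen_rank p n <= p.-1 * 'C(k, 2).
Proof.
move=> p_pr ltn; rewrite (leq_trans (sylow_gen_rank_le p_pr ltn)) //.
exact/gen_bound_le_bin/prime_gt1.
Qed.

(** * Chebyshev's bound and the factorization of factorials *)

Lemma prime_ndvd_fact p k : prime p -> k < p -> ~~ (p %| k`!).
Proof.
move=> p_pr; elim: k => [_|k IH ltk].
  by rewrite fact0 dvdn1; apply: contraTneq p_pr => ->.
by rewrite factS Euclid_dvdM // negb_or gtnNdvd //= IH // ltnW.
Qed.

Lemma prod_primes_dvd a b N :
    (forall p, a <= p < b -> prime p -> p %| N) ->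
  \prod_(a <= p < b | prime p) p %| N.
Proof.
elim: b => [|b IH] dvdN; first by rewrite big_geq ?dvd1n.
have [leab|ltba] := leqP a b; last by rewrite big_geq ?dvd1n.
have {}IH : \prod_(a <= p < b | prime p) p %| N.
  apply: IH => p /andP[leap ltpb]; apply: dvdN; rewrite leap ltnS.
  exact: ltnW.
rewrite big_mkcond big_nat_recr //= -big_mkcond /=.
case: ifP => b_pr; last by rewrite muln1.
rewrite Gauss_dvd ?IH ?dvdN ?leab //=.
rewrite big_nat_cond; elim/big_ind: _ => [|u v cu cv|p].
- exact: coprime1n.
- by rewrite coprimeMl cu.
case/andP => /andP[_ ltpb] p_pr.
by rewrite prime_coprime // dvdn_prime2 // ltn_eqF.
Qed.

(** By symmetry this coefficient occurs twice in the binomial expansion of [2 ^ m.*2.+1]. *)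
Lemma bin_odd_le m : 'C(m.*2.+1, m) <= 4 ^ m.
Proof.
rewrite -(leq_pmul2l (isT : 0 < 2)) (_ : 2 * 4 ^ m = 2 ^ m.*2.+1); last first.
  by rewrite expnS -mul2n expnM.
rewrite -[2 in leqRHS]/(1 + 1) Pascal.
have ltm1 : m.+1 < m.*2.+2 by rewrite !ltnS -addnn leq_addr.
have ltm : m < m.*2.+2 by exact: ltnW.
rewrite (bigD1 (Ordinal ltm)) //= (bigD1 (Ordinal ltm1)) /=; last first.
  by rewrite -val_eqE /= gtn_eqF.
rewrite !exp1n !mul1n !muln1 addnA mul2n -addnn.
rewrite -{2}(bin_sub (n := m.*2.+1)); last by rewrite -addnn -addnS leq_addr.
by rewrite (_ : m.*2.+1 - m = m.+1) ?leq_addr //; lia.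
Qed.

(** Erdős's induction: an even [n > 2] is not prime and reduces to [n - 1]; for [n = 2m + 1] the
    primes above [m + 1] divide ['C(n, m)], and the others are covered by the case [m + 1]. *)
Lemma primorial_le n : 0 < n -> \prod_(1 <= p < n.+1 | prime p) p <= 4 ^ n.-1.
Proof.
have [k le_nk] := ubnP n; elim: k n le_nk => // k IH n ltnk n_gt0.
have [n2|n2] := leqP n 2.
  case: n n2 {ltnk n_gt0} => [|[|[|]]] // _.
  - by rewrite big_geq.
  - by rewrite big_mkcond big_nat1.
  - by rewrite big_mkcond big_nat_recr //= big_nat1.
have [n_odd|n_even] := boolP (odd n); last first.
  have n_npr : ~~ prime n.
    by apply: contra n_even => /even_prime[n2'|//]; rewrite n2' in n2.
  rewrite big_mkcond big_nat_recr //= -big_mkcond /= (negPf n_npr) muln1.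
  have := IH n.-1; rewrite prednK // => /(_ _ _)/leq_trans-> //; try lia.
  by rewrite leq_pexp2l //; lia.
set m := n./2; have nE : n = m.*2.+1 by rewrite -[LHS]odd_double_half n_odd.
have m_gt0 : 0 < m by lia.
rewrite (@big_cat_nat _ _ _ m.+2) //=; try lia.
rewrite (_ : n.-1 = m + m); last lia.
rewrite expnD leq_mul //; first by apply: (IH m.+1); lia.
apply: leq_trans (bin_odd_le m); apply: dvdn_leq; first by rewrite bin_gt0; lia.
apply: prod_primes_dvd => p /andP[ltmp lepn] p_pr.
have: p %| n`! by apply: dvdn_fact; rewrite prime_gt0.
rewrite nE -(@bin_fact _ m); last lia.
rewrite Euclid_dvdM // => /orP[//|]; rewrite Euclid_dvdM //.
by rewrite !(negPf (prime_ndvd_fact p_pr _)) //; lia.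
Qed.

Lemma fact_prod_primes n : n`! = \prod_(1 <= p < n.+1 | prime p) p ^ logn p n`!.
Proof.
have le_nf : n <= n`!.
  by case: n => // n; rewrite dvdn_leq ?fact_gt0 // dvdn_fact //=.
rewrite -{1}[n`!]partnT ?fact_gt0 // /partn.
rewrite (@big_cat_nat _ _ _ n.+1) //= [X in _ * X = _](_ : _ = 1) ?muln1; last first.
  rewrite big_nat_cond big1 // => p /andP[/andP[ltnp _] _]; rewrite lognE.
  by case: and3P => // -[p_pr _]; rewrite (negPf (prime_ndvd_fact p_pr _)).
rewrite big_ltn // big_mkcond /= [RHS]big_mkcond mul1n; apply: eq_big_nat => p _.
by case: ifP => // p_npr; rewrite lognE p_npr.
Qed.

Lemma logn_fact_le p n : prime p -> p.-1 * logn p n`! <= n.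
Proof.
move=> p_pr; have p_gt1 := prime_gt1 p_pr.
have [k] := ubnP n; elim: k n => // k IH n ltnk.
have [->|n_gt0] := posnP n; first by rewrite logn1 muln0.
rewrite logn_fact_div //; have := IH (n %/ p).
have := divn_eq n p; have := ltn_Pdiv p_gt1 n_gt0; nia.
Qed.

Lemma leq_div_logn_fact p n : prime p -> n %/ p <= logn p n`!.
Proof. by move=> p_pr; rewrite logn_fact_div ?leq_addr. Qed.

From mathcomp Require Import all_boot all_order all_algebra ring lra.
From mathcomp Require Import all_classical all_reals all_analysis.

Import Order.TTheory GRing.Theory Num.Theory.
Import numFieldNormedType.Exports.
Local Open Scope classical_set_scope.
Local Open Scope ring_scope.

(** * Mertens' first theorem with explicit constants *)

Section FirstMertens.
Context (R : realType).
Implicit Types (x u v : R) (n m p : nat).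

Lemma lnB_le u v : 0 < u -> 0 < v -> ln v - ln u <= (v - u) / u.
Proof.
move=> u0 v0; rewrite -ln_div ?posrE //.
have -> : v / u = 1 + (v - u) / u by field; rewrite gt_eqF.
apply: le_ln1Dx; rewrite -subr_gt0 opprK.
by rewrite (_ : _ + 1 = v / u) ?divr_gt0 //; field; rewrite gt_eqF.
Qed.

Lemma lnB_ge u v : 0 < u -> 0 < v -> (v - u) / v <= ln v - ln u.
Proof.
move=> u0 v0; have := lnB_le v0 u0; rewrite -lerN2 opprB.
by rewrite -mulNr opprB.
Qed.

Lemma ln_natS_le n : (0 < n)%N -> ln n.+1%:R - ln n%:R <= n%:R^-1 :> R.
Proof.
move=> n0; have := @lnB_le n%:R n.+1%:R; rewrite !ltr0n => /(_ n0 isT)/le_trans->//.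
by rewrite -natr1 addrAC subrr add0r mul1r.
Qed.

Lemma ln_natS_ge n : (0 < n)%N -> n.+1%:R^-1 <= ln n.+1%:R - ln n%:R :> R.
Proof.
move=> n0; have := @lnB_ge n%:R n.+1%:R; rewrite !ltr0n => /(_ n0 isT); apply: le_trans.
by rewrite -natr1 addrAC subrr add0r mul1r.
Qed.

Lemma ln_nat_ge0 n : 0 <= ln n%:R :> R.
Proof. by case: n => [|n]; [rewrite ln0 | rewrite ln_ge0 // ler1n]. Qed.

Lemma ler_ln_nat m n : (0 < m)%N -> (m <= n)%N -> ln m%:R <= ln n%:R :> R.
Proof. by move=> m0 mn; rewrite ler_ln ?posrE ?ltr0n ?ler_nat // (leq_trans m0). Qed.

Lemma ln_nat_gt0 n : (1 < n)%N -> 0 < ln n%:R :> R.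
Proof. by move=> n1; rewrite ln_gt0 // ltr1n. Qed.

Lemma ln_prod (I : Type) (r : seq I) (P : pred I) (F : I -> R) :
    (forall i, P i -> 0 < F i) ->
  ln (\prod_(i <- r | P i) F i) = \sum_(i <- r | P i) ln (F i).
Proof.
move=> F0; suff [] : ln (\prod_(i <- r | P i) F i) = \sum_(i <- r | P i) ln (F i)
    /\ 0 < \prod_(i <- r | P i) F i by [].
elim/big_rec2: _ => [|i a b Pi [ln_b b0]]; first by rewrite ln1.
by rewrite lnM ?posrE ?F0 // ln_b mulr_gt0 ?F0.
Qed.

Lemma ln4 : ln 4 = 2 * ln 2 :> R.
Proof. by rewrite (_ : 4 = 2 ^+ 2) ?lnXn ?mulr_natl //; ring. Qed.

Lemma chebyshev_theta_le n : (0 < n)%N ->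
  \sum_(1 <= p < n.+1 | prime p) ln p%:R <= (n%:R - 1) * (2 * ln 2) :> R.
Proof.
move=> n0; rewrite -ln_prod => [|p /prime_gt0]; last by rewrite ltr0n.
rewrite -natr_prod; apply: (@le_trans _ _ (ln (4 ^ n.-1)%N%:R)).
  by apply: ler_ln_nat (primorial_le n0); apply: prodn_cond_gt0 => p /prime_gt0.
rewrite natrX lnXn // ln4 -[leLHS]mulr_natl.
by rewrite -subn1 natrB.
Qed.

Lemma ln_fact n :
  ln n`!%:R = \sum_(1 <= p < n.+1 | prime p) (logn p n`!)%:R * ln p%:R :> R.
Proof.
rewrite [in LHS]fact_prod_primes natr_prod ln_prod => [|p p_pr].
  apply: eq_bigr => p /prime_gt0 p0; rewrite natrX lnXn ?ltr0n //.
  by rewrite mulr_natl.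
by rewrite natrX exprn_gt0 // ltr0n prime_gt0.
Qed.

Lemma ln_fact_le n : (0 < n)%N ->
  ln n`!%:R <= (n%:R + 1) * ln n%:R - n%:R + 1 :> R.
Proof.
case: n => // n _; elim: n => [|n IH]; first by rewrite ln1; lra.
rewrite factS natrM lnM ?posrE ?ltr0n ?fact_gt0 //.
have := @ln_natS_ge n.+1 isT; move: IH.
set l := ln n.+1%:R; set l' := ln n.+2%:R.
have -> : n.+2%:R = n.+1%:R + 1 :> R by rewrite natr1.
have: 0 < n.+1%:R :> R by rewrite ltr0n.
move: (n.+1%:R : R) => x x0 IH h.
have : 1 <= (l' - l) * (x + 1) by rewrite -ler_pdivrMr ?div1r //; lra.
lra.
Qed.

Lemma ln_fact_ge n : n%:R * ln n%:R - n%:R <= ln n`!%:R :> R.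
Proof.
elim: n => [|[|n] IH]; first by rewrite mul0r subr0 fact0 ln1.
  by rewrite ln1 mulr0; lra.
rewrite factS natrM lnM ?posrE ?ltr0n ?fact_gt0 //.
have := @ln_natS_le n.+1 isT; move: IH.
set l := ln n.+1%:R; set l' := ln n.+2%:R.
have -> : n.+2%:R = n.+1%:R + 1 :> R by rewrite natr1.
have: 0 < n.+1%:R :> R by rewrite ltr0n.
move: (n.+1%:R : R) => x x0 IH h.
have : (l' - l) * x <= 1 by rewrite -ler_pdivlMr ?div1r.
lra.
Qed.

Definition prime_log_sum n : R := \sum_(1 <= p < n.+1 | prime p) ln p%:R / p%:R.

(** The exponent of [p] in the factorial of [n] is at least [n / p - 1]; weighting by [ln p] and
    summing costs one Chebyshev sum. *)
Lemma prime_log_sum_le n : (0 < n)%N ->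
  prime_log_sum n <= ln n%:R + (2 * ln 2 - 3 / 4).
Proof.
move=> n0; have x0 : 0 < n%:R :> R by rewrite ltr0n.
rewrite -(ler_pM2l x0).
have : n%:R * prime_log_sum n <= ln n`!%:R + \sum_(1 <= p < n.+1 | prime p) ln p%:R.
  rewrite ln_fact -big_split /= mulr_sumr; apply: ler_sum => p p_pr.
  have p0 : 0 < p%:R :> R by rewrite ltr0n prime_gt0.
  rewrite mulrCA mulrC -[X in _ <= _ + X]mul1r -mulrDl ler_wpM2r ?ln_nat_ge0 //.
  rewrite ler_pdivrMr // natr1 -natrM ler_nat ltnW // -ltn_divLR ?prime_gt0 //.
  by rewrite ltnS leq_div_logn_fact.
have := ln_fact_le n0; have := chebyshev_theta_le n0.
(* The tangent of [ln] at 4 absorbs the spare [ln n] of [ln_fact_le]. Its [ln 4] cancels the [- 1]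
   of Chebyshev's bound, and its slope turns [- n] into [- 3 / 4 * n]. *)
have : ln n%:R - 2 * ln 2 <= (n%:R - 4) / 4 :> R.
  by rewrite -ln4 lnB_le.
lra.
Qed.

(* Exact terms at 2 and 3; from 5 on, every integer is kept and
   [(ln m + 1) / (m - 1)] telescopes. *)
Lemma prime_log_tail_le n :
  \sum_(1 <= p < n.+1 | prime p) ln p%:R / (p%:R * (p%:R - 1))
    <= ln 2 / 2 + ln 3 / 6 + (ln 5 + 1) / 4 :> R.
Proof.
pose F p : R := ln p%:R / (p%:R * (p%:R - 1)).
have F0 p : 0 <= F p.
  case: p => [|p]; first by rewrite /F ln0 // mul0r.
  by rewrite divr_ge0 ?ln_nat_ge0 // mulr_ge0 // -natr1 addrK.
pose T n := \sum_(1 <= p < n.+1 | prime p) F p.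
have TS m : T m.+1 = T m + (if prime m.+1 then F m.+1 else 0).
  by rewrite /T big_mkcond big_nat_recr //= -big_mkcond.
rewrite -/(T n).
suff H m : T m.+4 + (ln m.+1.+4%:R + 1) / m.+4%:R
    <= ln 2 / 2 + ln 3 / 6 + (ln 5 + 1) / 4.
  apply: le_trans (H n); apply: (@le_trans _ _ (T n.+4)).
    rewrite !TS -!addrA lerDl !addr_ge0 //; by case: ifP.
  by rewrite lerDl divr_ge0 // addr_ge0 // ln_nat_ge0.
elim: m => [|m].
  rewrite !TS /= {1}/T big_geq // /F.
  have -> : 2 * (2 - 1) = 2 :> R by ring.
  have -> : 3 * (3 - 1) = 6 :> R by ring.
  lra.
apply: le_trans; rewrite TS -addrA lerD2l.
apply: (@le_trans _ _ (F m.+1.+4 + (ln m.+2.+4%:R + 1) / m.+1.+4%:R)).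
  by rewrite lerD2r; case: ifP.
have := @ln_natS_le m.+1.+4 isT; rewrite /F.
move: (ln m.+2.+4%:R) (ln m.+1.+4%:R) => l' l.
rewrite -[m.+1.+4%:R]natr1 addrK.
have : 0 < m.+4%:R :> R by rewrite ltr0n.
move: (m.+4%:R : R) => x x0 h.
have x1 : 0 < x + 1 by lra.
have xx0 : x != 0 by rewrite gt_eqF.
have xx1 : x + 1 != 0 by rewrite gt_eqF.
rewrite -subr_ge0.
have -> : (l + 1) / x - (l / ((x + 1) * x) + (l' + 1) / (x + 1))
  = ((x + 1)^-1 - (l' - l)) / (x + 1) + (1 / x / (x + 1) - 1 / (x + 1) / (x + 1)).
  by field; rewrite xx1.
rewrite addr_ge0 ?divr_ge0 ?subr_ge0 //; first lra.
rewrite -!mulrA ler_pM2l // ler_pM2r ?invr_gt0 // lef_pV2 ?posrE //; lra.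
Qed.

(** The exponent of [p] in the factorial is at most [n / (p - 1)], and
    [1 / (p - 1) = 1 / p + 1 / (p * (p - 1))]; the second part sums to the bounded tail. The leading
    1 comes from [ln_fact_ge]. *)
Lemma prime_log_sum_ge n : (0 < n)%N ->
  ln n%:R - (1 + (ln 2 / 2 + ln 3 / 6 + (ln 5 + 1) / 4)) <= prime_log_sum n.
Proof.
move=> n0; have x0 : 0 < n%:R :> R by rewrite ltr0n.
rewrite -(ler_pM2l x0).
have : ln n`!%:R <= n%:R * (prime_log_sum n +
    \sum_(1 <= p < n.+1 | prime p) ln p%:R / (p%:R * (p%:R - 1))).
  rewrite ln_fact -big_split /= mulr_sumr; apply: ler_sum => p p_pr.
  have p1 : 0 < p%:R - 1 :> R by rewrite subr_gt0 ltr1n prime_gt1.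
  have p0 : p%:R != 0 :> R by rewrite pnatr_eq0 -lt0n prime_gt0.
  rewrite (_ : n%:R * _ = n%:R / (p%:R - 1) * ln p%:R); last first.
    by field; rewrite p0 gt_eqF.
  rewrite ler_wpM2r ?ln_nat_ge0 // ler_pdivlMr // mulrC.
  have := logn_fact_le n p_pr; rewrite -(ler_nat R) natrM.
  by rewrite -subn1 natrB ?prime_gt0.
have := ln_fact_ge n; have := prime_log_tail_le n.
move: (ln _ / 2 + _ + _) => S; nra.
Qed.

End FirstMertens.

(** * Numerical bounds for logarithms *)

Section NumericalBounds.
Context (R : realType).
Implicit Types (x u v : R) (n m p : nat).

Lemma exp_series_le_expR x n : 0 <= x -> series (exp_coeff x) n <= expR x.
Proof.
move=> x0; apply: nondecreasing_cvgn_le; last exact: is_cvg_series_exp_coeff.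
by apply: nondecreasing_series => i _ _; rewrite /exp_coeff divr_ge0 ?exprn_ge0.
Qed.

Lemma ln_le_of_le_series x (y : R) n :
  0 <= x -> 0 < y -> y <= series (exp_coeff x) n -> ln y <= x.
Proof.
move=> x0 y0 le_y; rewrite -[leRHS]expRK ler_ln ?posrE ?expR_gt0 //.
exact: le_trans le_y (exp_series_le_expR _ x0).
Qed.

Lemma ln2_le : ln 2 <= 7 / 10 :> R.
Proof.
apply: (@ln_le_of_le_series _ _ 5); rewrite ?divr_ge0 // !seriesEnat /=.
rewrite !big_nat_recr //= big_geq // /exp_coeff /= !factS fact0; lra.
Qed.

Lemma ln3_le : ln 3 <= 11 / 10 :> R.
Proof.
apply: (@ln_le_of_le_series _ _ 6); rewrite ?divr_ge0 // !seriesEnat /=.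
rewrite !big_nat_recr //= big_geq // /exp_coeff /= !factS fact0; lra.
Qed.

Lemma ln5_le : ln 5 <= 165 / 100 :> R.
Proof.
apply: (@ln_le_of_le_series _ _ 6); rewrite ?divr_ge0 // !seriesEnat /=.
rewrite !big_nat_recr //= big_geq // /exp_coeff /= !factS fact0; lra.
Qed.

Lemma ln27_le : ln (27 / 10) <= 1 :> R.
Proof.
apply: (@ln_le_of_le_series _ _ 5); rewrite ?divr_gt0 // !seriesEnat /=.
rewrite !big_nat_recr //= big_geq // /exp_coeff /= !factS fact0; lra.
Qed.

(* Coefficientwise, [(1 - t) exp (2 t)] is [1 + t] plus nonpositive terms. *)
Lemma expR_double_le t : 0 <= t < 1 -> expR (2 * t) <= (1 + t) / (1 - t) :> R.
Proof.
move=> /andP[t0 t1]; have t1' : 0 < 1 - t by lra.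
have c0 n : 0 <= exp_coeff (2 * t) n by rewrite /exp_coeff divr_ge0 ?exprn_ge0 ?mulr_ge0.
have S_le n : series (exp_coeff (2 * t)) n.+2 * (1 - t)
    <= 1 + t - t * exp_coeff (2 * t) n.+1.
  elim: n => [|n IH].
    rewrite seriesEnat /= !big_nat_recr //= big_geq // /exp_coeff /=.
    by rewrite expr0 expr1 !divr1; lra.
  have -> : series (exp_coeff (2 * t)) n.+3
      = series (exp_coeff (2 * t)) n.+2 + exp_coeff (2 * t) n.+2.
    by rewrite !seriesEnat /= big_nat_recr.
  suff : exp_coeff (2 * t) n.+2 <= t * exp_coeff (2 * t) n.+1 by lra.
  have -> : exp_coeff (2 * t) n.+2 = 2 / n.+2%:R * (t * exp_coeff (2 * t) n.+1).
    rewrite /exp_coeff /= factS natrM exprS; field.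
    by rewrite -natrD !pnatr_eq0 -lt0n fact_gt0.
  rewrite -[leRHS]mul1r ler_wpM2r ?(mulr_ge0 t0 (c0 _)) // ler_pdivrMr ?ltr0n // mul1r.
  by rewrite ler_nat.
apply: limr_le; first exact: is_cvg_series_exp_coeff.
near=> n; have [k ->] : exists k, n = k.+2.
  by exists n.-2; rewrite -[LHS](@subnK 2) ?addn2 ?subn2 //; near: n; exists 2%N.
rewrite ler_pdivlMr //; apply: le_trans (S_le k) _.
by rewrite gerBl (mulr_ge0 t0 (c0 _)).
Unshelve. all: by end_near.
Qed.

(** Take [t = 1 / (2 * n + 1)] in [expR_double_le]: then [(1 + t) / (1 - t) = (n + 1) / n]. *)
Lemma ln_natS_midpoint n :
  (0 < n)%N -> 2 / (2 * n%:R + 1) <= ln n.+1%:R - ln n%:R :> R.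
Proof.
move=> n0; have x0 : 0 < n%:R :> R by rewrite ltr0n.
rewrite -ln_div ?posrE ?ltr0n // -[leLHS]expRK ler_ln ?posrE ?expR_gt0 ?divr_gt0 //.
have -> : 2 / (2 * n%:R + 1) = 2 * (1 / (2 * n%:R + 1)) :> R by rewrite div1r.
apply: le_trans (expR_double_le _) _.
  by rewrite divr_ge0 ?ltr_pdivrMr; lra.
rewrite le_eqVlt -natr1; apply/orP; left; apply/eqP; field.
by rewrite gt_eqF //= gt_eqF //; lra.
Qed.

(** Midpoint steps from 4 to 8 give about 0.6912, enough for the later uses of [69 / 100] and
    [20 / 29]. *)
Lemma ln2_ge : 2 / 9 + 2 / 11 + 2 / 13 + 2 / 15 <= ln 2 :> R.
Proof.
have h4 : 2 / 9 <= ln 5 - ln 4 :> R.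
  by rewrite (_ : 9 = 2 * 4%:R + 1) ?ln_natS_midpoint //; ring.
have h5 : 2 / 11 <= ln 6 - ln 5 :> R.
  by rewrite (_ : 11 = 2 * 5%:R + 1) ?ln_natS_midpoint //; ring.
have h6 : 2 / 13 <= ln 7 - ln 6 :> R.
  by rewrite (_ : 13 = 2 * 6%:R + 1) ?ln_natS_midpoint //; ring.
have h7 : 2 / 15 <= ln 8 - ln 7 :> R.
  by rewrite (_ : 15 = 2 * 7%:R + 1) ?ln_natS_midpoint //; ring.
have ln8 : ln 8 = ln 4 + ln 2 :> R.
  by rewrite -lnM ?posrE //; congr ln; ring.
lra.
Qed.

End NumericalBounds.

(** * Sums of reciprocals of primes *)

Section SecondMertens.
Context (R : realType).
Implicit Types (x u v : R) (n m p : nat).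

Lemma prime_log_sumS n :
  prime_log_sum R n.+1
    = prime_log_sum R n + (if prime n.+1 then ln n.+1%:R / n.+1%:R else 0).
Proof. by rewrite /prime_log_sum big_mkcond big_nat_recr //= -big_mkcond. Qed.

Definition prime_inv_sum m n : R := \sum_(m <= p < n.+1 | prime p) p%:R^-1.

Lemma prime_inv_sumS m n : (m <= n.+1)%N ->
  prime_inv_sum m n.+1 = prime_inv_sum m n
    + (prime_log_sum R n.+1 - prime_log_sum R n) / ln n.+1%:R.
Proof.
move=> le_mn; rewrite /prime_inv_sum big_mkcond big_nat_recr //= -big_mkcond.
rewrite prime_log_sumS addrAC subrr add0r; congr (_ + _).
case: ifP => [p_pr|_]; last by rewrite mul0r.
by rewrite mulrAC divff ?mul1r // gt_eqF // ln_nat_gt0 // prime_gt1.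
Qed.

(* The distance between the bounds of [prime_log_sum_ge] and [prime_log_sum_le]. *)
Definition mertens_width : R :=
  1 + (ln 2 / 2 + ln 3 / 6 + (ln 5 + 1) / 4) + (2 * ln 2 - 3 / 4).

Lemma mertens_width_le : mertens_width <= 2846 / 1000.
Proof.
by have := ln2_le R; have := ln3_le R; have := ln5_le R; rewrite /mertens_width; lra.
Qed.

(* Abel summation against [1 / ln m].  As these weights are decreasing, the
   bounds on [prime_log_sum - ln] contribute only through their difference
   [mertens_width]. *)
Lemma prime_inv_sum_abel_le m k : (0 < m)%N ->
  prime_inv_sum m.+1 (m + k).+1
    <= (mertens_width + m%:R^-1) / ln m.+1%:R
       + (ln (ln (m + k).+1%:R) - ln (ln m.+1%:R)).
Proof.
move=> m0; pose b : R := 2 * ln 2 - 3 / 4.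
pose D n : R := prime_log_sum R n - ln n%:R - b.
have D_le0 n : (0 < n)%N -> D n <= 0.
  by move=> n0; have := prime_log_sum_le R n0; rewrite /D /b; lra.
have l0 n : (0 < n)%N -> 0 < ln n.+1%:R :> R by move=> ?; rewrite ln_nat_gt0.
suff : prime_inv_sum m.+1 (m + k).+1 <= (mertens_width + m%:R^-1) / ln m.+1%:R
    + D (m + k).+1 / ln (m + k).+1%:R
    + (ln (ln (m + k).+1%:R) - ln (ln m.+1%:R)).
  move/le_trans; apply; rewrite lerD2r gerDl.
  by rewrite mulr_le0_ge0 ?D_le0 // invr_ge0 ltW // l0 // addn_gt0 m0.
elim: k => [|k IH].
  rewrite addn0 prime_inv_sumS // {1}/prime_inv_sum big_geq // add0r.
  rewrite subrr addr0 -mulrDl ler_pM2r ?invr_gt0 ?l0 //.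
  have := prime_log_sum_ge R m0; have := ln_natS_le R m0.
  rewrite /D /mertens_width -/b; lra.
rewrite addnS prime_inv_sumS; last by rewrite ltnS -addnS leq_addr.
set n := (m + k).+1 in IH *; have n0 : (0 < n)%N by [].
have n1 : (1 < n)%N by rewrite ltnS addn_gt0 m0.
have ln0 : 0 < ln n%:R :> R by rewrite ln_nat_gt0.
have ln'0 := l0 n n0.
have le_ln : ln n%:R <= ln n.+1%:R :> R by rewrite ler_ln_nat.
have hl := lnB_ge ln0 ln'0; have D0 := D_le0 n n0.
have : D n / ln n%:R <= D n / ln n.+1%:R.
  by rewrite ler_wnM2l // lef_pV2 ?posrE.
have -> : prime_log_sum R n.+1 - prime_log_sum R n
    = D n.+1 - D n + (ln n.+1%:R - ln n%:R) by rewrite /D; ring.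
move: (D n) (D n.+1) IH => d d'; lra.
Qed.

Lemma ln_nat_concave n : (0 < n)%N ->
  ln n.+2%:R - ln n.+1%:R <= ln n.+1%:R - ln n%:R :> R.
Proof.
move=> n0; rewrite -!ln_div ?posrE ?ltr0n // ler_ln ?posrE ?divr_gt0 ?ltr0n //.
rewrite ler_pdivrMr ?ltr0n // mulrAC ler_pdivlMr ?ltr0n // -!natrM ler_nat; lia.
Qed.

(** The increment of [ln ln] from [n] to [n + 1] exceeds the Abel term, so it cannot be used from
    below. Concavity allows the next increment instead, from [n + 1] to [n + 2]; hence the shifted
    endpoint [(m + k).+2] in the induction. *)
Lemma prime_inv_sum_abel_ge m k : (0 < m)%N ->
  ln (ln (m + k).+1%:R) - ln (ln m.+1%:R) - mertens_width / ln m.+1%:R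
    <= prime_inv_sum m.+1 (m + k).+1.
Proof.
move=> m0; pose a : R := 1 + (ln 2 / 2 + ln 3 / 6 + (ln 5 + 1) / 4).
pose D n : R := prime_log_sum R n - ln n%:R + a.
have D_ge0 n : (0 < n)%N -> 0 <= D n.
  by move=> n0; have := prime_log_sum_ge R n0; rewrite /D /a; lra.
have l0 n : (0 < n)%N -> 0 < ln n.+1%:R :> R by move=> ?; rewrite ln_nat_gt0.
have step n : (0 < n)%N ->
    ln (ln n.+2%:R) - ln (ln n.+1%:R) <= (ln n.+1%:R - ln n%:R) / ln n.+1%:R :> R.
  move=> n0; apply: (le_trans (lnB_le (l0 n n0) (l0 n.+1 isT))).
  by rewrite ler_pM2r ?invr_gt0 ?l0 // ln_nat_concave.
suff : ln (ln (m + k).+2%:R) - ln (ln m.+1%:R) - mertens_width / ln m.+1%:R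
    + D (m + k).+1 / ln (m + k).+1%:R <= prime_inv_sum m.+1 (m + k).+1.
  apply: le_trans; rewrite -[leLHS]addr0 lerD //; last first.
    by rewrite divr_ge0 ?D_ge0 // ltW // l0 // addn_gt0 m0.
  rewrite !lerD2r ler_ln ?posrE ?l0 ?addn_gt0 ?m0 //.
  by rewrite ler_ln_nat.
elim: k => [|k IH].
  rewrite addn0 prime_inv_sumS // /prime_inv_sum big_geq // add0r.
  have := step m m0; have := prime_log_sum_le R m0.
  have -> : prime_log_sum R m.+1 - prime_log_sum R m
    = D m.+1 - mertens_width + (ln m.+1%:R - ln m%:R)
      + (ln m%:R + (2 * ln 2 - 3 / 4) - prime_log_sum R m).
    by rewrite /D /mertens_width /a; ring.
  move=> h; rewrite -subr_ge0 in h; have := divr_ge0 h (ltW (l0 m m0)).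
  move: (D m.+1) (_ - prime_log_sum R m) mertens_width => d e w; lra.
rewrite addnS prime_inv_sumS; last by rewrite ltnS -addnS leq_addr.
set n := (m + k).+1 in IH *; have n0 : (0 < n)%N by [].
have n1 : (1 < n)%N by rewrite ltnS addn_gt0 m0.
have ln0 : 0 < ln n%:R :> R by rewrite ln_nat_gt0.
have ln'0 := l0 n n0.
have le_ln : ln n%:R <= ln n.+1%:R :> R by rewrite ler_ln_nat.
have hl := step n n0; have D0 := D_ge0 n n0.
have : D n / ln n.+1%:R <= D n / ln n%:R.
  by rewrite ler_wpM2l // lef_pV2 ?posrE.
have -> : prime_log_sum R n.+1 - prime_log_sum R n
    = D n.+1 - D n + (ln n.+1%:R - ln n%:R) by rewrite /D; ring.
move: (D n) (D n.+1) IH => d d'; lra.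
Qed.

Section AroundSqrt.
Context (n y : nat) (n2 : (2 <= n)%N).
Context (le_yn : (y ^ 2 <= n)%N) (lt_ny : (n < y.+1 ^ 2)%N).

Lemma sqrt_floor_gt0 : (0 < y)%N.
Proof. by move: n2 lt_ny; case: y => // ? ?; lia. Qed.

Lemma sqrt_floor_lt : (y < n)%N.
Proof. by move: n2 le_yn lt_ny; nia. Qed.

Lemma ln_half_le : ln n%:R / 2 <= ln y.+1%:R :> R.
Proof.
rewrite ler_pdivrMr // mulr_natr -lnXn ?ltr0n // -natrX.
by apply: ler_ln_nat; lia.
Qed.

Lemma ln_half_ge : ln y%:R <= ln n%:R / 2 :> R.
Proof.
have y0 := sqrt_floor_gt0.
rewrite ler_pdivlMr // mulr_natr -lnXn ?ltr0n // -natrX.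
by apply: ler_ln_nat; rewrite ?expn_gt0 ?y0.
Qed.

Lemma prime_inv_sum_sqrt_le :
  prime_inv_sum y.+1 n <= ln 2 + 2 * (mertens_width + y%:R^-1) / ln n%:R.
Proof.
have y0 := sqrt_floor_gt0; have L0 : 0 < ln n%:R :> R by rewrite ln_nat_gt0.
have := prime_inv_sum_abel_le (n - y.+1) y0.
rewrite -addSn subnKC ?sqrt_floor_lt // => /le_trans; apply.
have w0 : 0 <= mertens_width + y%:R^-1.
  have h2 := ln2_ge R; have h3 := ln_nat_ge0 R 3; have h5 := ln_nat_ge0 R 5.
  by rewrite addr_ge0 ?invr_ge0 // /mertens_width; lra.
have ly0 : 0 < ln y.+1%:R :> R by rewrite ln_nat_gt0.
rewrite addrC lerD //.
  rewrite -ln_div ?posrE // ler_ln ?posrE ?divr_gt0 // ler_pdivrMr //.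
  by have := ln_half_le; lra.
rewrite -mulrA mulrCA ler_wpM2l // -[leRHS]invrK invfM invrK.
by rewrite lef_pV2 ?posrE ?mulr_gt0 // mulrC ln_half_le.
Qed.

Lemma prime_inv_sum_sqrt_ge :
  ln 2 - 2 * (mertens_width + y%:R^-1) / ln n%:R <= prime_inv_sum y.+1 n.
Proof.
have y0 := sqrt_floor_gt0; have L0 : 0 < ln n%:R :> R by rewrite ln_nat_gt0.
have := prime_inv_sum_abel_ge (n - y.+1) y0.
rewrite -addSn subnKC ?sqrt_floor_lt // => /(le_trans _); apply.
have w0 : 0 <= mertens_width.
  have h2 := ln2_ge R; have h3 := ln_nat_ge0 R 3; have h5 := ln_nat_ge0 R 5.
  by rewrite /mertens_width; lra.
have ly0 : 0 < ln y.+1%:R :> R by rewrite ln_nat_gt0.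
(* Since [y.+1] overshoots the square root, its logarithm may exceed half of [ln n], by at most
   [1 / y]; this costs [2 * y^-1 / ln n]. *)
have lyE : ln y.+1%:R <= ln n%:R / 2 + y%:R^-1 :> R.
  by have := ln_natS_le R y0; have := ln_half_ge; lra.
have h1 : ln (ln y.+1%:R) <= ln (ln n%:R / 2) + y%:R^-1 / (ln n%:R / 2) :> R.
  have L20 : 0 < ln n%:R / 2 :> R by rewrite divr_gt0.
  have s0 : 0 < ln n%:R / 2 + y%:R^-1 :> R by rewrite addr_gt0 // invr_gt0 ltr0n.
  have := lnB_le L20 s0; rewrite [in leRHS]addrAC subrr add0r.
  have : ln (ln y.+1%:R) <= ln (ln n%:R / 2 + y%:R^-1) :> R by rewrite ler_ln ?posrE.
  lra.
rewrite ln_div ?posrE // in h1.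
have h2 : mertens_width / ln y.+1%:R <= 2 * mertens_width / ln n%:R.
  rewrite -mulrA mulrCA ler_wpM2l // -[leRHS]invrK invfM invrK.
  by rewrite lef_pV2 ?posrE ?mulr_gt0 // mulrC ln_half_le.
have h3 : y%:R^-1 / (ln n%:R / 2) = 2 * y%:R^-1 / ln n%:R :> R.
  by field; rewrite gt_eqF //= pnatr_eq0 -lt0n.
rewrite h3 in h1; rewrite mulrDr mulrDl; lra.
Qed.

End AroundSqrt.

End SecondMertens.

(** * The lower bound *)

Section LowerBound.
Context (R : realType).
Implicit Types (x u v : R) (n m p : nat).

Lemma sqrt_floor n : exists2 y : nat, (y ^ 2 <= n)%N & (n < y.+1 ^ 2)%N.
Proof.
elim: n => [|n [y le_y lt_y]]; first by exists 0%N.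
have [lt_y2|le_y2] := ltnP n.+1 (y.+1 ^ 2)%N.
  by exists y; rewrite // leqW.
by exists y.+1; [exact: le_y2 | nia].
Qed.

(** Every prime counted has [ln p >= ln n / 2], so the count is at most [2 / ln n] times Chebyshev's
    sum. *)
Lemma prime_count_sqrt_le n y :
    (2 <= n)%N -> (y ^ 2 <= n)%N -> (n < y.+1 ^ 2)%N ->
  \sum_(y.+1 <= p < n.+1 | prime p) 1 <= 4 * ln 2 * n%:R / ln n%:R :> R.
Proof.
move=> n2 le_yn lt_ny; have L0 : 0 < ln n%:R :> R by rewrite ln_nat_gt0.
have le_y : ln n%:R / 2 <= ln y.+1%:R :> R by exact: ln_half_le.
have le_sum : ln n%:R / 2 * (\sum_(y.+1 <= p < n.+1 | prime p) 1)
    <= \sum_(1 <= p < n.+1 | prime p) ln p%:R :> R.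
  rewrite mulr_sumr; have [lt_yn|le_ny] := ltnP y n.+1; last first.
    rewrite big_geq; last exact: leqW.
    by apply: sumr_ge0 => p _; rewrite ln_nat_ge0.
  rewrite (@big_cat_nat _ _ _ y.+1 1 n.+1) //= -[leLHS]add0r lerD //.
    by apply: sumr_ge0 => p _; rewrite ln_nat_ge0.
  rewrite big_nat_cond [leRHS]big_nat_cond.
  apply: ler_sum => p /andP[/andP[lt_yp _] _]; rewrite mulr1.
  by apply: le_trans le_y _; apply: ler_ln_nat.
have := chebyshev_theta_le R (ltnW n2); move/(le_trans le_sum) => {}le_sum.
rewrite ler_pdivlMr //; have := ln2_ge R; move: le_sum; nra.
Qed.

Lemma total_gen_rank_natr n : (total_gen_rank n)%:R =
  \sum_(1 <= p < n.+1 | prime p) (sylow_gen_rank p n)%:R :> R.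
Proof. by rewrite /total_gen_rank natr_sum big_mkcond big_ltn //= add0r -big_mkcond. Qed.

Lemma ltr_natr_div n p : (0 < p)%N -> n%:R / p%:R < (n %/ p)%:R + 1 :> R.
Proof.
move=> p0; rewrite ltr_pdivrMr ?ltr0n // natr1 -natrM ltr_nat -ltn_divLR //.
Qed.

Lemma ler_div_natr n p : (n %/ p)%:R <= n%:R / p%:R :> R.
Proof.
case: p => [|p]; first by rewrite divn0 invr0 mulr0.
by rewrite ler_pdivlMr ?ltr0n // -natrM ler_nat leq_trunc_div.
Qed.

Lemma total_gen_rank_ge n : (2 <= n)%N ->
  n%:R * ln 2 - 12 * n%:R / ln n%:R <= (total_gen_rank n)%:R :> R.
Proof.
move=> n2; have [y le_yn lt_ny] := sqrt_floor n.
have y0 := sqrt_floor_gt0 n2 le_yn lt_ny; have lt_yn := sqrt_floor_lt n2 le_yn lt_ny.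
have L0 : 0 < ln n%:R :> R by rewrite ln_nat_gt0.
have x0 : 0 < n%:R :> R by rewrite ltr0n ltnW.
rewrite total_gen_rank_natr (@big_cat_nat _ _ _ y.+1) //=; last by rewrite ltnW.
set small := (\sum_(1 <= p < y.+1 | _) _).
have : 0 <= small by apply: sumr_ge0 => p _; rewrite ler0n.
have : n%:R * prime_inv_sum R y.+1 n - \sum_(y.+1 <= p < n.+1 | prime p) 1
    <= \sum_(y.+1 <= p < n.+1 | prime p) (sylow_gen_rank p n)%:R.
  rewrite /prime_inv_sum mulr_sumr -sumrB big_nat_cond [leRHS]big_nat_cond.
  apply: ler_sum => p /andP[/andP[lt_yp _] p_pr].
  rewrite sylow_gen_rank_large //; last first.
    by apply: leq_trans lt_ny _; rewrite leq_exp2r.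
  by rewrite lerBlDr ltW // ltr_natr_div // prime_gt0.
have := ler_pM2l x0; move/(_ _ _)/esym => mul_le.
have := prime_inv_sum_sqrt_ge R n2 le_yn lt_ny; rewrite mul_le.
have := prime_count_sqrt_le n2 le_yn lt_ny.
have y1 : y%:R^-1 <= 1 :> R by rewrite invf_le1 ?ltr0n // ler1n.
have w := mertens_width_le R; have l2 := ln2_le R.
(* With [y] possibly equal to 1, the coefficient is at most [2 * (2.846 + 1) + 4 * 0.7 = 10.492]. *)
have : n%:R / ln n%:R * (2 * (mertens_width R + y%:R^-1) + 4 * ln 2)
    <= n%:R / ln n%:R * 12 :> R.
  by rewrite ler_wpM2l ?divr_ge0 ?(ltW x0) ?(ltW L0) //; lra.
lra.
Qed.

End LowerBound.

(** * Primes up to the square root *)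

Section SmallPrimes.
Context (R : realType).
Implicit Types (x u v : R) (n m p : nat).

Lemma ln3_ge1 : 1 <= ln 3 :> R.
Proof.
have h : 2 / 5 <= ln 3 - ln 2 :> R.
  by rewrite (_ : 5 = 2 * 2%:R + 1) ?ln_natS_midpoint //; ring.
by have := ln2_ge R; lra.
Qed.

Lemma div_ln_mono u v : 0 < u -> 1 <= ln u -> u <= v -> u * ln v <= v * ln u.
Proof.
move=> u0 lu uv; have v0 : 0 < v by exact: lt_le_trans uv.
have : u * (ln v - ln u) <= v - u by rewrite mulrC -ler_pdivlMr // lnB_le.
have : v - u <= (v - u) * ln u by rewrite ler_peMr // subr_ge0.
lra.
Qed.

(** The function [t / ln t] increases only from [e] on. The prime 2 lies below [e], but takes the
    same value as 4 there, whence the condition on [v]. *)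
Lemma prime_mul_ln_le p v : prime p -> p%:R <= v -> 4 <= v ->
  p%:R * ln v <= v * ln p%:R.
Proof.
move=> p_pr pv v4; have [p3|] := leqP 3 p.
  apply: div_ln_mono; rewrite ?ltr0n ?prime_gt0 //.
  by apply: le_trans ln3_ge1 _; apply: ler_ln_nat.
rewrite ltnS => p2; have -> : p = 2%N.
  by apply/eqP; rewrite eqn_leq p2 prime_gt1.
have := @div_ln_mono 4 v; rewrite ln4; have := ln2_ge R => l2.
move=> /(_ _ _ v4) h; have {}h := h ltac:(lra) ltac:(lra); lra.
Qed.

(** Monotonicity of [t / ln t] gives [p <= s * ln p / ln s] for [s = sqrt n >= 4], which reduces the
    sum to Chebyshev's. *)
Lemma sum_primes_sqrt_le n y : (16 <= n)%N -> (y ^ 2 <= n)%N ->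
  \sum_(1 <= p < y.+1 | prime p) p%:R <= 4 * ln 2 * n%:R / ln n%:R :> R.
Proof.
move=> n16 le_yn; set s := Num.sqrt n%:R : R.
have L0 : 0 < ln n%:R :> R by rewrite ln_nat_gt0 // (leq_trans _ n16).
have s2 : s ^+ 2 = n%:R by rewrite sqr_sqrtr.
have le_s m : (m ^ 2 <= n)%N -> m%:R <= s.
  move=> le_mn; rewrite -[m%:R]ger0_norm // -sqrtr_sqr ler_wsqrtr //.
  by rewrite -natrX ler_nat.
have s0 : 0 < s by rewrite sqrtr_gt0 ltr0n (leq_trans _ n16).
have ln_s : ln n%:R = 2 * ln s by rewrite -s2 lnXn // mulr_natl.
have [->|y0] := posnP y.
  by rewrite big_geq // divr_ge0 ?mulr_ge0 ?(ltW L0) // ln_nat_ge0.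
rewrite ler_pdivlMr // mulr_suml ln_s.
apply: (@le_trans _ _ (\sum_(1 <= p < y.+1 | prime p) 2 * s * ln p%:R)).
  rewrite big_nat_cond [leRHS]big_nat_cond.
  apply: ler_sum => p /andP[/andP[_ le_py] p_pr].
  rewrite mulrCA -mulrA ler_pM2l //; apply: prime_mul_ln_le => //.
    by apply: le_s; apply: leq_trans le_yn; rewrite leq_exp2r.
  exact: (le_s 4).
rewrite -mulr_sumr; apply: (@le_trans _ _ (2 * s * (y%:R * (2 * ln 2)))).
  rewrite ler_wpM2l ?mulr_ge0 ?(ltW s0) //.
  apply: le_trans (chebyshev_theta_le R y0) _.
  by rewrite ler_wpM2r ?mulr_ge0 ?ln_nat_ge0 //; lra.
have : y%:R * (2 * ln 2) <= s * (2 * ln 2).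
  by rewrite ler_wpM2r ?le_s // mulr_ge0 // ln_nat_ge0.
move=> /(ler_wpM2l (ltW s0)); rewrite -s2; lra.
Qed.

Lemma sum_inv_sqr_le m n : (0 < m)%N ->
  \sum_(m.+1 <= p < n.+1) (p%:R ^+ 2)^-1 <= m%:R^-1 :> R.
Proof.
move=> m0; have [lt_nm|le_mn] := ltnP n m.
  by rewrite big_geq ?invr_ge0 // ltnS ltnW.
suff : \sum_(m.+1 <= p < n.+1) (p%:R ^+ 2)^-1 <= m%:R^-1 - n%:R^-1 :> R.
  by move/le_trans; apply; rewrite gerBl invr_ge0.
rewrite -(subnKC le_mn); elim: (n - m)%N => [|k IH].
  by rewrite addn0 big_geq // subrr.
rewrite addnS big_nat_recr; last by rewrite ltnS leq_addr.
set q := (m + k)%N in IH *; rewrite /= -[leRHS](subrKA q%:R^-1).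
have q0 : 0 < q%:R :> R by rewrite ltr0n addn_gt0 m0.
apply: lerD IH _; rewrite -natr1; move: (q%:R : R) q0 => x x0.
have x1 : 0 < x + 1 by lra.
rewrite (_ : x^-1 - _ = (x * (x + 1))^-1); last by field; rewrite !gt_eqF.
rewrite lef_pV2 ?posrE ?mulr_gt0 ?exprn_gt0 // expr2 ler_pM2r //; lra.
Qed.

Lemma sum_natr_le z : \sum_(1 <= p < z.+1) (p%:R - 1) <= z%:R ^+ 2 / 2 :> R.
Proof.
elim: z => [|z IH]; first by rewrite big_geq // expr0n mul0r.
by rewrite big_nat_recr //= -natr1; lra.
Qed.

(* At least ['C(k, 2)], where [k] is the number of base-[p] digits of [n],
   for every [p >= 2]. *)
Definition digit_count_bound n : R := (ln n%:R / ln 2) * (ln n%:R / ln 2 + 1) / 2.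

Lemma digit_count_bound_ge0 n : 0 <= digit_count_bound n.
Proof.
have h : 0 <= ln n%:R / ln 2 :> R by rewrite divr_ge0 // ln_nat_ge0.
by rewrite /digit_count_bound divr_ge0 // mulr_ge0 // addr_ge0.
Qed.

Lemma sylow_gen_rank_le_ln p n : prime p -> (0 < n)%N ->
  (sylow_gen_rank p n)%:R <= (p%:R - 1) * digit_count_bound n.
Proof.
move=> p_pr n0; have p1 := prime_gt1 p_pr; set j := trunc_log p n.
have := sylow_gen_rank_le_bin p_pr (trunc_log_ltn n p1).
rewrite -(ler_nat R) => /le_trans; apply.
rewrite natrM -subn1 natrB ?prime_gt0 // ler_wpM2l ?subr_ge0 ?ler1n ?prime_gt0 //.
have l2 : 0 < ln 2 :> R by exact: ln_nat_gt0.
have le_j : j%:R <= ln n%:R / ln 2 :> R.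
  rewrite ler_pdivlMr // mulr_natl -lnXn // -natrX; apply: ler_ln_nat.
    by rewrite expn_gt0.
  apply: leq_trans (trunc_logP p1 n0); rewrite -/j.
  by have [->|j0] := posnP j; rewrite // leq_exp2r.
rewrite /digit_count_bound ler_pdivlMr // -natrM.
have -> : ('C(j.+1, 2) * 2 = j * j.+1)%N.
  by rewrite mulnC -(mul_bin_diag j.+1 1) bin1 mulnC.
rewrite natrM -natr1 ler_pM // ?addr_ge0 //; lra.
Qed.

Lemma sylow_gen_rank_le_natr_sqr p n : prime p ->
  (sylow_gen_rank p n)%:R <= p%:R + 2 * n%:R * (p%:R ^+ 2)^-1 :> R.
Proof.
move=> p_pr; have := sylow_gen_rank_le_sqr n p_pr; rewrite -(ler_nat R).
move/le_trans; apply; rewrite natrD natrM lerD2l -mulrA ler_pM2l // -natrX.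
exact: ler_div_natr.
Qed.

(** Up to [z] the digit-count bound is used, beyond [z] the bound [p + 2 n / p ^ 2]. The cut [z]
    will be the integer part of [n ^ (1/4)]. *)
Lemma small_primes_le n y z : (0 < z)%N -> (0 < n)%N -> (z <= y)%N ->
  \sum_(1 <= p < y.+1 | prime p) (sylow_gen_rank p n)%:R
    <= \sum_(1 <= p < y.+1 | prime p) p%:R
       + (z%:R ^+ 2 / 2 * digit_count_bound n + 2 * n%:R / z%:R) :> R.
Proof.
move=> z0 n0 le_zy.
have q0 := digit_count_bound_ge0 n.
rewrite [leLHS](@big_cat_nat _ _ _ z.+1) //=.
rewrite [X in _ <= X + _](@big_cat_nat _ _ _ z.+1) //=.
have h1 : \sum_(1 <= p < z.+1 | prime p) (sylow_gen_rank p n)%:R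
    <= z%:R ^+ 2 / 2 * digit_count_bound n.
  apply: le_trans (ler_wpM2r q0 (sum_natr_le z)); rewrite mulr_suml.
  rewrite big_mkcond /= big_nat_cond [leRHS]big_nat_cond.
  apply: ler_sum => p /andP[/andP[p0 _] _].
  case: ifP => p_pr; first exact: sylow_gen_rank_le_ln.
  by rewrite mulr_ge0 // subr_ge0 ler1n.
have h2 : \sum_(z.+1 <= p < y.+1 | prime p) (sylow_gen_rank p n)%:R
    <= \sum_(z.+1 <= p < y.+1 | prime p) p%:R + 2 * n%:R / z%:R :> R.
  apply: (@le_trans _ _ (\sum_(z.+1 <= p < y.+1 | prime p)
    (p%:R + 2 * n%:R * (p%:R ^+ 2)^-1))).
    by apply: ler_sum => p; apply: sylow_gen_rank_le_natr_sqr.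
  rewrite big_split /= lerD2l -mulr_sumr ler_wpM2l //.
  apply: le_trans (sum_inv_sqr_le y z0); rewrite big_mkcond /=.
  by apply: ler_sum => p _; case: ifP => // _; rewrite invr_ge0 exprn_ge0.
have h3 : 0 <= \sum_(1 <= p < z.+1 | prime p) p%:R :> R by apply: sumr_ge0.
lra.
Qed.

End SmallPrimes.

(** * The upper bound *)

Section UpperBound.
Context (R : realType).
Implicit Types (x u v : R) (n m p : nat).

Lemma large_primes_le n y :
    (2 <= n)%N -> (y ^ 2 <= n)%N -> (n < y.+1 ^ 2)%N ->
  \sum_(y.+1 <= p < n.+1 | prime p) (sylow_gen_rank p n)%:R
    <= n%:R * ln 2 + 2 * (mertens_width R + y%:R^-1) * n%:R / ln n%:R :> R.
Proof.
move=> n2 le_yn lt_ny.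
apply: (@le_trans _ _ (n%:R * prime_inv_sum R y.+1 n)); last first.
  apply: le_trans (ler_wpM2l (ler0n _ _) (prime_inv_sum_sqrt_le R n2 le_yn lt_ny)) _.
  by rewrite mulrDr lerD2l mulrCA mulrA mulrAC.
rewrite /prime_inv_sum mulr_sumr; apply: ler_sum => p p_pr.
apply: le_trans (ler_div_natr R n p); rewrite ler_nat.
exact: sylow_gen_rank_le_div.
Qed.

(* The constant comes from [ln t <= t / 2.7] for [t = sqrt x], as [64 / 2.7 ^ 2 < 9]. *)
Lemma ln_sqr_le x : 1 <= x -> (4 * ln x) ^+ 2 <= 9 * x.
Proof.
move=> x1; have x0 : 0 < x by exact: lt_le_trans x1.
set t := Num.sqrt x; have t0 : 0 < t by rewrite sqrtr_gt0.
have t2 : t ^+ 2 = x by rewrite sqr_sqrtr ?ltW.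
have t1 : 1 <= t by rewrite -sqrtr1 ler_wsqrtr.
have lt : ln t <= t * 10 / 27.
  have := @lnB_le R (27 / 10) t; rewrite divr_gt0 // => /(_ isT t0).
  have -> : (t - 27 / 10) / (27 / 10) = t * 10 / 27 - 1 by field.
  by have := ln27_le R; lra.
rewrite -t2 lnXn // -[ln t *+ 2]mulr_natl.
have lt0 : 0 <= ln t by rewrite ln_ge0.
have : ln t ^+ 2 <= (t * 10 / 27) ^+ 2 by rewrite lerXn2r ?nnegrE //; lra.
have := sqr_ge0 t; lra.
Qed.

Definition upper_bound (x : R) : R :=
  x * ln 2 + 19 * x / (2 * ln x) + 137 * x / (2 * ln x ^+ 2)
    + 4 * Num.sqrt x / ln x + 3 * Num.sqrt x / 2 * ln x.

Lemma upper_boundE x : 1 < x ->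
  upper_bound x = x * ln 2 + x / ln x * (19 / 2) + x / ln x ^+ 2 * (137 / 2)
    + 4 * Num.sqrt x / ln x + 3 / 2 * Num.sqrt x * ln x.
Proof.
move=> x1; have L0 : ln x != 0 by rewrite gt_eqF ?ln_gt0.
by rewrite /upper_bound; field.
Qed.

(** The crude estimate [n * ln n] suffices while [ln n <= 4.4]. The threshold is [3 ^ 4], from which
    the cut [n ^ (1/4)] is at least 3. *)
Lemma total_gen_rank_le_small n : (2 <= n)%N -> (n <= 81)%N ->
  (total_gen_rank n)%:R <= upper_bound n%:R.
Proof.
move=> n2 n81; have L0 : 0 < ln n%:R :> R by rewrite ln_nat_gt0.
have le_L : ln n%:R <= 44 / 10 :> R.
  apply: (@le_trans _ _ (ln (3 ^ 4)%N%:R)).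
    by apply: ler_ln_nat => //; exact: ltnW.
  by rewrite natrX lnXn //; have := ln3_le R; lra.
have harm k : \sum_(1 <= p < k.+1 | prime p) p%:R^-1 <= ln k%:R :> R.
  elim: k => [|[|k] IH]; first by rewrite big_geq // ln0.
    by rewrite big_mkcond big_nat1 /= ln1.
  rewrite big_mkcond big_nat_recr //= -big_mkcond /=.
  have := ln_natS_ge R (isT : (0 < k.+1)%N).
  have : 0 <= k.+2%:R^-1 :> R by rewrite invr_ge0.
  move=> i0 h; apply: le_trans (lerD IH (lexx _)) _; move: i0 h.
  move: (k.+2%:R^-1) (ln k.+2%:R) (ln k.+1%:R) => a b c a0 h.
  by case: ifP => _; lra.
have x0 : 0 <= n%:R :> R by rewrite ler0n.
apply: (@le_trans _ _ (n%:R * ln n%:R)).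
  rewrite total_gen_rank_natr; apply: le_trans (ler_wpM2l x0 (harm n)).
  rewrite mulr_sumr; apply: ler_sum => p p_pr.
  apply: le_trans (ler_div_natr R n p); rewrite ler_nat.
  exact: sylow_gen_rank_le_div.
rewrite upper_boundE ?ltr1n //.
have s0 := sqrtr_ge0 (n%:R : R).
have : 0 <= 4 * Num.sqrt n%:R / ln n%:R :> R by rewrite divr_ge0 ?(ltW L0) ?mulr_ge0.
have : 0 <= 3 / 2 * Num.sqrt n%:R * ln n%:R :> R.
  by rewrite !mulr_ge0 ?(ltW L0) // divr_ge0.
suff : n%:R * ln n%:R <= n%:R * ln 2 + n%:R / ln n%:R * (19 / 2)
    + n%:R / ln n%:R ^+ 2 * (137 / 2) :> R by lra.
have := ln2_ge R; move: (ln 2) (ln n%:R) L0 le_L => l L L0 le_L le_l.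
have -> : n%:R * l + n%:R / L * (19 / 2) + n%:R / L ^+ 2 * (137 / 2)
   = n%:R * ((L ^+ 2 * l + 19 / 2 * L + 137 / 2) / L ^+ 2).
  by field; rewrite gt_eqF.
rewrite ler_wpM2l // ler_pdivlMr ?exprn_gt0 //.
have : L * L <= L * (44 / 10) by rewrite ler_pM2l.
have : L * L ^+ 2 <= (44 / 10) * L ^+ 2 by rewrite ler_pM2r ?exprn_gt0.
have : L ^+ 2 * (69 / 100) <= L ^+ 2 * l by rewrite ler_pM2l ?exprn_gt0 //; lra.
lra.
Qed.

(** Applied to [r = n ^ (1/4)] and [M = ln n ^ 2]. The two summands contribute 24 and 42.93, within
    [137 / 2]. *)
Lemma small_error_le (r M : R) : 0 < r -> 0 < M -> M <= 9 * r ->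
  (8 / 3 * r ^+ 3 + r ^+ 2 / 2 * (53 / 50 * M)) * M <= r ^+ 4 * (137 / 2).
Proof.
move=> r0 M0 le_M.
have h1 : r ^+ 3 * M <= r ^+ 3 * (9 * r) by rewrite ler_pM2l ?exprn_gt0.
have h2 : M * M <= (9 * r) * (9 * r) by rewrite ler_pM // ltW.
have h3 : r ^+ 2 * (M * M) <= r ^+ 2 * ((9 * r) * (9 * r)).
  by rewrite ler_pM2l ?exprn_gt0.
have : 0 < r ^+ 4 by rewrite exprn_gt0.
move: h1 h3; lra.
Qed.

(** Now [y >= 9], so the coefficient is at most [2 * (2.846 + 1 / 9) + 4 * 0.7 < 8.72], within
    [19 / 2]. *)
Lemma main_terms_le n y : (81 <= n)%N -> (y ^ 2 <= n)%N -> (n < y.+1 ^ 2)%N ->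
  \sum_(y.+1 <= p < n.+1 | prime p) (sylow_gen_rank p n)%:R
    + \sum_(1 <= p < y.+1 | prime p) p%:R
    <= n%:R * ln 2 + n%:R / ln n%:R * (19 / 2) :> R.
Proof.
move=> n81 le_yn lt_ny; have n2 : (2 <= n)%N by exact: leq_trans n81.
have n16 : (16 <= n)%N by exact: leq_trans n81.
have y9 : (9 <= y)%N by nia.
have q0 : 0 <= n%:R / ln n%:R :> R by rewrite divr_ge0 ?ln_nat_ge0.
have inv_y : y%:R^-1 <= 9^-1 :> R.
  by rewrite lef_pV2 ?posrE ?ltr0n ?ler_nat // (leq_trans _ y9).
have : n%:R / ln n%:R * (2 * (mertens_width R + y%:R^-1) + 4 * ln 2)
    <= n%:R / ln n%:R * (19 / 2) :> R.
  rewrite ler_wpM2l //; move: inv_y (mertens_width_le R) (ln2_le R).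
  move: (y%:R^-1) (mertens_width R) (ln 2) => i w l; lra.
have := large_primes_le n2 le_yn lt_ny; have := sum_primes_sqrt_le R n16 le_yn.
move: (bigop _ _ _) (bigop _ _ _) (n%:R * ln 2) => S1 S2 T; lra.
Qed.

Lemma digit_count_bound_le n :
  digit_count_bound R n <= 53 / 50 * ln n%:R ^+ 2 + 3 / 4 * ln n%:R.
Proof.
have l0 := ln_nat_ge0 R n.
(* As [1 / ln 2 <= 29 / 20], the coefficients are [(29 / 20) ^ 2 / 2 = 1.05125] and [29 / 40]. *)
have le_L : ln n%:R / ln 2 <= 29 / 20 * ln n%:R :> R.
  rewrite ler_pdivrMr ?ln_nat_gt0 // mulrAC ler_peMl //.
  by have := ln2_ge R; lra.
have q0 : 0 <= ln n%:R / ln 2 :> R by rewrite divr_ge0 ?ln_nat_ge0.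
have : (ln n%:R / ln 2) ^+ 2 <= (29 / 20 * ln n%:R) ^+ 2 :> R.
  by rewrite lerXn2r ?nnegrE // (le_trans q0).
rewrite /digit_count_bound; move: le_L l0 (sqr_ge0 (ln n%:R : R)); clear q0.
move: (@ln R n%:R / ln 2) (@ln R n%:R) => q L; lra.
Qed.

Lemma error_terms_le n z : (81 <= n)%N -> (z ^ 4 <= n)%N -> (n < z.+1 ^ 4)%N ->
  z%:R ^+ 2 / 2 * digit_count_bound R n + 2 * n%:R / z%:R
    <= n%:R / ln n%:R ^+ 2 * (137 / 2) + 3 / 2 * Num.sqrt n%:R * ln n%:R.
Proof.
move=> n81 le_zn lt_nz; have n2 : (2 <= n)%N by exact: leq_trans n81.
have z3 : (3 <= z)%N.
  by rewrite -ltnS -(ltn_exp2r _ _ (isT : 0 < 4)%N) (leq_ltn_trans n81).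
have L0 : 0 < ln n%:R :> R by rewrite ln_nat_gt0.
have x0 : 0 < n%:R :> R by rewrite ltr0n ltnW.
set s : R := Num.sqrt n%:R; have s2 : s ^+ 2 = n%:R by rewrite sqr_sqrtr ?ltW.
have s0 : 0 < s by rewrite sqrtr_gt0.
set r : R := Num.sqrt s; have r2 : r ^+ 2 = s by rewrite sqr_sqrtr ?ltW.
have r0 : 0 < r by rewrite sqrtr_gt0.
have nr : n%:R = r ^+ 4 by rewrite -s2 -r2; ring.
have L2 : ln n%:R ^+ 2 <= 9 * r.
  rewrite nr lnXn // -[ln r *+ 4]mulr_natl ln_sqr_le //.
  by rewrite -sqrtr1 ler_wsqrtr // -sqrtr1 ler_wsqrtr // ler1n ltnW.
have le_zr : z%:R ^+ 2 <= s.
  rewrite -[z%:R ^+ 2]ger0_norm ?exprn_ge0 // -sqrtr_sqr ler_wsqrtr //.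
  by rewrite -exprM -natrX ler_nat.
have lt_rz : r < z%:R + 1.
  by rewrite natr1 -(@ltr_pXn2r _ 4) ?nnegrE ?(ltW r0) // -nr -natrX ltr_nat.
(* Rounding down to [z >= 3] loses at most a factor [4 / 3], because [r < z + 1 <= 4 / 3 * z]. *)
have inv_z : z%:R^-1 <= 4 / 3 / r.
  have -> : 4 / 3 / r = (3 / 4 * r)^-1 by field; rewrite gt_eqF.
  have z3' : 3 <= z%:R :> R by rewrite ler_nat.
  rewrite lef_pV2 ?posrE ?mulr_gt0 //; first by move: lt_rz z3'; clear; lra.
  exact: lt_le_trans z3'.
have h1 : z%:R ^+ 2 / 2 * digit_count_bound R n
    <= s / 2 * (53 / 50 * ln n%:R ^+ 2 + 3 / 4 * ln n%:R).
  have hz0 : 0 <= z%:R ^+ 2 / 2 :> R by rewrite divr_ge0 ?exprn_ge0.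
  apply: ler_pM hz0 (digit_count_bound_ge0 R n) _ (digit_count_bound_le n).
  by rewrite ler_pM2r ?invr_gt0.
have h2 : 2 * n%:R / z%:R <= 8 / 3 * r ^+ 3.
  apply: (@le_trans _ _ (2 * n%:R * (4 / 3 / r))).
    by rewrite ler_pM2l ?mulr_gt0.
  by rewrite nr (_ : _ * (4 / 3 / r) = 8 / 3 * r ^+ 3) //; field; rewrite gt_eqF.
have h3 : 8 / 3 * r ^+ 3 + s / 2 * (53 / 50 * ln n%:R ^+ 2)
    <= n%:R / ln n%:R ^+ 2 * (137 / 2).
  rewrite [leRHS]mulrAC ler_pdivlMr ?exprn_gt0 //.
  by have := small_error_le r0 (exprn_gt0 2 L0) L2; rewrite -nr r2.
have h4 : 0 <= s * ln n%:R by rewrite mulr_ge0 ?(ltW s0) ?(ltW L0).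
apply: le_trans (lerD h1 h2) _; move: h3 h4.
move: (n%:R / @ln R n%:R ^+ 2 * (137 / 2)); move: (@ln R n%:R) => L T; clear; lra.
Qed.

Lemma total_gen_rank_le_large n : (81 <= n)%N ->
  (total_gen_rank n)%:R <= upper_bound n%:R.
Proof.
move=> n81; have n2 : (2 <= n)%N by exact: leq_trans n81.
have [y le_yn lt_ny] := sqrt_floor n; have [z le_zy lt_yz] := sqrt_floor y.
have lt_yn := sqrt_floor_lt n2 le_yn lt_ny.
have z0 : (0 < z)%N by nia.
have le_zy' : (z <= y)%N by apply: leq_trans le_zy; rewrite -mulnn leq_pmulr.
have le_zn : (z ^ 4 <= n)%N.
  by apply: leq_trans le_yn; rewrite (expnM z 2 2) leq_exp2r.
have lt_nz : (n < z.+1 ^ 4)%N.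
  by apply: leq_trans lt_ny _; rewrite (expnM z.+1 2 2) leq_exp2r.
rewrite total_gen_rank_natr (@big_cat_nat _ _ _ y.+1) //=; last by rewrite ltnW.
have := small_primes_le R z0 (ltnW n2) le_zy'.
have := main_terms_le n81 le_yn lt_ny; have := error_terms_le n81 le_zn lt_nz.
have : 0 <= 4 * Num.sqrt n%:R / ln n%:R :> R.
  by rewrite divr_ge0 ?ln_nat_ge0 // mulr_ge0 ?sqrtr_ge0.
rewrite upper_boundE ?ltr1n //; clear.
move: (4 * _ / _) (3 / 2 * _ * _) (_ / _ * (137 / 2)) (n%:R * ln 2 + _) => A B C D.
move: (_ * digit_count_bound R n + _) => E; lra.
Qed.

Lemma total_gen_rank_le n : (2 <= n)%N ->
  (total_gen_rank n)%:R <= upper_bound n%:R.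
Proof.
move=> n2; have [le|gt] := leqP n 81; first exact: total_gen_rank_le_small.
exact/total_gen_rank_le_large/ltnW.
Qed.

(** After division by [n / ln n] the case [n = 2] is the tight one: the terms are bounded by
    [9.5 + 99.11 + 2.84 + 0.53 = 111.98]. From 3 on [ln n >= 1], and [9.5 + 68.5 + 4 + 13.5 = 95.5]
    is enough. *)
Lemma upper_bound_le n : (2 <= n)%N ->
  upper_bound n%:R <= n%:R * ln 2 + 112 * n%:R / ln n%:R.
Proof.
move=> n2; have L0 : 0 < ln n%:R :> R by rewrite ln_nat_gt0.
have x0 : 0 < n%:R :> R by rewrite ltr0n ltnW.
set s : R := Num.sqrt n%:R; have s2 : s ^+ 2 = n%:R by rewrite sqr_sqrtr ?ltW.
have s0 : 0 < s by rewrite sqrtr_gt0.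
rewrite upper_boundE ?ltr1n // -/s.
suff : 19 / 2 + 137 / 2 / ln n%:R + 4 / s + 3 / 2 * ln n%:R ^+ 2 / s <= 112.
  move=> /(ler_wpM2l (ltW (divr_gt0 x0 L0))).
  rewrite -s2 (_ : s ^+ 2 / ln (s ^+ 2) * (_ + _) =
    s ^+ 2 / ln (s ^+ 2) * (19 / 2) + s ^+ 2 / ln (s ^+ 2) ^+ 2 * (137 / 2)
    + 4 * s / ln (s ^+ 2) + 3 / 2 * s * ln (s ^+ 2)); first lra.
  by field; rewrite s2 !gt_eqF.
have [n3|] := leqP 3 n; last first.
  rewrite ltnS => le_n2; have n2E : n = 2%N by apply/eqP; rewrite eqn_leq le_n2.
  have ge_s : 141 / 100 <= s.
    have h : 0 <= 141 / 100 :> R by rewrite divr_ge0.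
    rewrite -(@ler_pXn2r _ 2) ?nnegrE ?(ltW s0) // s2 n2E; clear; lra.
  rewrite n2E in L0 *; have l2 := ln2_le R; have l2' := ln2_ge R.
  have h1 : 137 / 2 / ln 2 <= 9911 / 100 :> R.
    by rewrite ler_pdivrMr //; move: l2'; clear; lra.
  have h2 : 4 / s <= 284 / 100.
    by rewrite ler_pdivrMr //; move: ge_s; clear; lra.
  have h3 : ln 2 ^+ 2 <= (7 / 10) ^+ 2 :> R.
    by rewrite lerXn2r ?nnegrE ?(ltW L0) ?divr_ge0.
  have h4 : 3 / 2 * ln 2 ^+ 2 / s <= 53 / 100.
    by rewrite ler_pdivrMr //; move: ge_s h3; clear; lra.
  move: h1 h2 h4; clear; lra.
have L1 : 1 <= ln n%:R :> R by apply: le_trans (ln3_ge1 R) _; apply: ler_ln_nat.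
have s1 : 1 <= s by rewrite -sqrtr1 ler_wsqrtr // ler1n ltnW.
have h1 : 137 / 2 / ln n%:R <= 137 / 2 :> R by rewrite ler_pdivrMr // ler_peMr.
have h2 : 4 / s <= 4 by rewrite ler_pdivrMr // ler_peMr.
have L2 : ln n%:R ^+ 2 <= 9 * s.
  set r : R := Num.sqrt s; have r2 : r ^+ 2 = s by rewrite sqr_sqrtr ?ltW.
  have r0 : 0 < r by rewrite sqrtr_gt0.
  have r1 : 1 <= r by rewrite -sqrtr1 ler_wsqrtr.
  rewrite -s2 -r2 -exprM lnXn // -[ln r *+ _]mulr_natl.
  apply: le_trans (ln_sqr_le r1) _.
  by rewrite ler_pM2l // expr2 ler_peMl // ltW.
have h3 : 3 / 2 * ln n%:R ^+ 2 / s <= 3 / 2 * 9.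
  by rewrite ler_pdivrMr //; move: L2; clear; lra.
move: h1 h2 h3; clear; lra.
Qed.

End UpperBound.

Theorem theorem5p1 (R : realType) :
  (forall n : nat, (2 <= n)%N ->
    let x : R := n%:R in
    let d : R := (total_gen_rank n)%:R in
    let B : R := x * ln 2 + 19 * x / (2 * ln x) + 137 * x / (2 * ln x ^+ 2)
                 + 4 * Num.sqrt x / ln x + 3 * Num.sqrt x / 2 * ln x in
    [/\ x * ln 2 - 12 * x / ln x <= d,
        d <= B &
        B <= x * ln 2 + 112 * x / ln x])
  /\ (fun n : nat => (total_gen_rank n)%:R : R) =
     (fun n : nat => n%:R * ln 2 : R) +O_\oo (fun n : nat => n%:R / ln n%:R : R).
Proof.
split=> [n n2 x d B|].
  split; first exact: total_gen_rank_ge; first exact: total_gen_rank_le.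
  exact: upper_bound_le.
apply/eqaddOP/bigO_exP; exists 112; first by [].
exists 2%N => // n /= n2.
have q0 : 0 <= n%:R / ln n%:R :> R by rewrite divr_ge0 ?ln_nat_ge0.
rewrite !fctE (ger0_norm q0) ler_norml lerBrDl lerBlDl.
have lo := total_gen_rank_ge R n2.
have up := le_trans (total_gen_rank_le R n2) (upper_bound_le R n2).
move: lo up q0; rewrite -!mulrA.
move: (n%:R / ln n%:R) (n%:R * ln 2) => q a lo up q0; apply/andP; split; lra.
Qed.
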